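(* Let $A=\mathbb{R}$, $\hat A=\{a_1,\dots,a_k\}\subset\mathbb{R}$ finite, and let $\rho:A\times\hat A\to[0,M]$ ($M<\infty$) be a (measurable) bounded distortion function with $\sup_{x\in A}\min_{y\in\hat A}\rho(x,y)=0$. Let $P$ be a Borel probability measure on $\mathbb{R}$ with $D_{\max}=\min_{y\in\hat A}E_P[\rho(X,y)]>0$, and suppose there is a nonempty open interval $I\subset\mathbb{R}$ on which $P$ has an absolutely continuous component (with respect to Lebesgue measure) with density $g$ satisfying $g(x)>0$ for $x\in I$. Write $r_j(x)=\rho(x,a_j)$ for $1\le j\le k$ and $r_0(x)\equiv 0$, and assume that each $r_j$ is continuous on $I$. Let $X_1\sim P$, and for $D\in(0,D_{\max})$ let $f=f_D:A\to\mathbb{R}$ be the function defined in the context. If for every $\lambda<0$ the functions $$e^{\lambda r_j(\cdot)},\qquad j=0,1,\dots,k,$$ are linearly independent on $I$, then for no $D\in(0,D_{\max})$ is $f_D(X_1)$ equal to zero with probability one.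
   Context: $\log$ is to base 2 and $\log_e$ is the natural logarithm. For a probability mass function $Q$ on $\hat A$ and $D\ge 0$ let $$R(P,Q,D)=\inf_{(X,Z)}\big[I(X;Z)+H(Q_Z\|Q)\big],$$ where the infimum is over jointly distributed $(X,Z)$ with values in $A\times\hat A$ such that $X$ has distribution $P$ and $E[\rho(X,Z)]\le D$; $Q_Z$ is the distribution of $Z$, $I(X;Z)$ is mutual information in bits, and $H(R\|Q)=\sum_{a}R(a)\log[R(a)/Q(a)]$ is relative entropy in bits. The rate-distortion function is $R(D)=\inf_{(X,Y)} I(X;Y)$, the infimum being over jointly distributed $(X,Y)$ in $A\times\hat A$ with $X\sim P$ and $E[\rho(X,Y)]\le D$; thus $R(D)=\inf_Q R(P,Q,D)$, the infimum being over all probability mass functions $Q$ on $\hat A$. For $\lambda\le 0$ let $\Lambda_{P,Q}(\lambda)=E_P\big[\log_e E_Q\big(e^{\lambda\rho(X,Y)}\big)\big]$, where $X\sim P$ and $Y\sim Q$ are independent and the inner expectation is over $Y$ only; let $\Lambda^*_{P,Q}(D)=\sup_{\lambda\le 0}[\lambda D-\Lambda_{P,Q}(\lambda)]$. Known facts used to define $f$: for every $D\in(0,D_{\max})$ there is a $Q^*$ with $R(P,Q^*,D)=R(D)$, and for such a $Q^*$ there is a unique $\lambda^*<0$ with $\Lambda'_{P,Q^*}(\lambda^* )=D$; it satisfies $\lambda^*D-\Lambda_{P,Q^*}(\lambda^* )=\Lambda^*_{P,Q^*}(D)=(\log_e 2)R(P,Q^*,D)=(\log_e 2)R(D)$. For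 each $D\in(0,D_{\max})$ choose such $Q^*$ and $\lambda^*$ (depending on $D$) and define, for $x\in A$, $$f(x)=f_D(x)=(\log e)\Big[\lambda^*D-\log_e E_{Q^*}\big(e^{\lambda^*\rho(x,Y)}\big)\Big]-R(D),\qquad Y\sim Q^*.$$ *)

(* Defs.v *)
From HB Require Import structures.
From mathcomp Require Import all_boot all_order all_algebra.
From mathcomp Require Import all_classical all_reals all_analysis.

Set Implicit Arguments.
Unset Strict Implicit.
Unset Printing Implicit Defensive.

Import Order.TTheory GRing.Theory Num.Theory.
Import numFieldNormedType.Exports.

Local Open Scope classical_set_scope.
Local Open Scope ring_scope.
Local Open Scope charge_scope.

Definition log2 (R : realType) (x : R) : R := ln x / ln 2.

Section relative_entropy.
Context d (T : measurableType d) (R : realType).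

(* Relative entropy in bits.  Integrating against [nu] makes the value of
   [log2] at 0 irrelevant: the density vanishes only on a [nu]-null set. *)
Definition KL_div (nu mu : probability T R) : \bar R :=
  if `[< nu `<< mu >] then
    (\int[nu]_x (log2 (fine
       (('d (charge_of_finite_measure nu) '/d mu) x)))%:E)%E
  else +oo%E.

End relative_entropy.

Section mutual_information.
Context d1 d2 (T1 : measurableType d1) (T2 : measurableType d2) (R : realType).

HB.instance Definition _ := isMeasurableFun.Build _ _ _ _
  (fst : T1 * T2 -> T1) (@measurable_fst _ _ T1 T2).
HB.instance Definition _ := isMeasurableFun.Build _ _ _ _
  (snd : T1 * T2 -> T2) (@measurable_snd _ _ T1 T2).

(* Mutual information of a pair with joint law W. *)
Definition mutual_info (W : probability (T1 * T2)%type R) : \bar R :=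
  KL_div W (distribution W fst \x distribution W snd)%E.

End mutual_information.

(* The reproduction alphabet is {a j | j < k} with [a] injective, and a
   probability mass function on it is indexed by 'I_k: [Q j] is the mass of
   [a j].  The distortion [rho] is a function on R * R of which only the values
   [rho x (a j)] matter. *)

Section rate_distortion.
Context (R : realType) (k : nat).
Implicit Types (a : 'I_k -> R) (rho : R -> R -> R) (P : probability R R)
  (Q : 'I_k -> R) (D l x : R).

Definition is_pmf Q := (forall j, 0 <= Q j) /\ \sum_j Q j = 1.

(* Conventions 0 log (0 / q) = 0 and r log (r / 0) = +oo for r > 0, which
   totalized division and logarithm would not give. *)
Definition rel_entropy (S Q : 'I_k -> R) : \bar R :=
  (\sum_(j < k) (if S j == 0%R then 0
                 else if Q j == 0%R then +oo
                 else (S j * log2 (S j / Q j))%:E))%E.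

Definition pmf_snd a (W : probability (R * R)%type R) : 'I_k -> R :=
  fun j => fine (W (setT `*` [set a j])).

(* Laws of the pairs (X, Z) with values in R * range a such that X ~ P and
   E[rho(X, Z)] <= D. *)
Definition joint_laws a rho P D : set (probability (R * R)%type R) :=
  [set W | [/\ forall B : set R, measurable B -> W (B `*` setT) = P B,
               W (setT `*` range a) = 1%E
             & (\int[W]_(z in setT `*` range a) (rho z.1 z.2)%:E
                  <= D%:E)%E]].

Definition rate_wrt a rho P Q D : \bar R :=
  ereal_inf [set (mutual_info W + rel_entropy (pmf_snd a W) Q)%E
            | W in joint_laws a rho P D].

Definition rate_distortion a rho P D : \bar R :=
  ereal_inf [set mutual_info W | W in joint_laws a rho P D].

Definition D_max a rho P : \bar R :=
  \big[Order.min/+oo%E]_(j < k) ('E_P[fun x => rho x (a j)])%E.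

Definition log_mgf a rho Q l x : R :=
  ln (\sum_j Q j * expR (l * rho x (a j))).

Definition Lambda a rho P Q l : R := \int[P]_x log_mgf a rho Q l x.

(* [Q] and [l] are an admissible choice of Q^* and lambda^* at level D. *)
Definition optimal_pair a rho P D Q l : Prop :=
  [/\ is_pmf Q,
      rate_wrt a rho P Q D = rate_distortion a rho P D,
      l < 0
    & is_derive l 1 (Lambda a rho P Q) D].

(* [fine] is harmless: for a nonnegative distortion with
   sup_x min_j rho x (a j) = 0 and D > 0, the rate-distortion function takes
   values in [0, log2 k]. *)
Definition f_fun a rho P D Q l x : R :=
  log2 (expR 1) * (l * D - log_mgf a rho Q l x)
  - fine (rate_distortion a rho P D).

(* r_0 = 0 and r_j = rho(., a_j) for 1 <= j <= k; the letters are numbered from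
   0 in [a], hence the shift by [unlift]. *)
Definition r_fun a rho (j : 'I_k.+1) : R -> R :=
  fun x => if unlift ord0 j is Some i then rho x (a i) else 0.

End rate_distortion.

Definition lin_indep_on (R : realType) (n : nat) (I : set R)
    (h : 'I_n -> R -> R) : Prop :=
  forall c : 'I_n -> R,
    (forall x, I x -> \sum_j c j * h j x = 0) -> forall j, c j = 0.

(* On I, [g] is the density of the absolutely continuous part in the Lebesgue
   decomposition of P. *)
Definition ac_density_on (R : realType) (P : probability R R) (I : set R)
    (g : R -> R) : Prop :=
  [/\ measurable_fun I g,
      forall x, I x -> 0 <= g x
    & exists2 sigma : {measure set (measurableTypeR R) -> \bar R},
        exists N : set R, [/\ measurable N, lebesgue_measure N = 0%E
                            & sigma (~` N) = 0%E]
      & forall B : set R, measurable B -> B `<=` I ->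
          P B = (\int[lebesgue_measure]_(x in B) (g x)%:E + sigma B)%E].

(* Main.v *)
(** If [f_D(X_1) = 0] almost surely, then solving [f_D = 0] shows that the
    exponential sum [\sum_j Q^*_j e^(l r_j)] equals a constant [C] at [P]-almost
    every point.  Since [P] charges every nonempty open subset of [I] and the
    exponential sum is continuous on [I], it equals [C] everywhere on [I].  This
    is a linear relation among the [e^(l r_j)], with coefficient [-C] at
    [r_0 = 0], so independence forces [Q^* = 0], which is not a probability mass
    function. *)

Require Import Defs.
From HB Require Import structures.
From mathcomp Require Import all_boot all_order all_algebra.
From mathcomp Require Import all_classical all_reals all_analysis.
From mathcomp Require Import measurable_realfun.

Set Implicit Arguments.
Unset Strict Implicit.
Unset Printing Implicit Defensive.

Import Order.TTheory GRing.Theory Num.Theory.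
Import numFieldNormedType.Exports.

Local Open Scope classical_set_scope.
Local Open Scope ring_scope.

(** A vanishing integral of [f = |f|] would force [f = 0] almost everywhere on [A]; as [f] has no
    zero there, [A] would lie in a null set. *)
Lemma integral_gt0_pos d (T : measurableType d) (R : realType)
    (mu : {measure set T -> \bar R}) (A : set T) (f : T -> R) :
  measurable A -> measurable_fun A f -> (forall x, A x -> 0 < f x) ->
  (0 < mu A)%E -> (0 < \int[mu]_(x in A) (f x)%:E)%E.
Proof.
move=> mA mf f_gt0 muA.
have f_ge0 x : A x -> (0 <= (f x)%:E)%E by move=> Ax; rewrite lee_fin ltW ?f_gt0.
rewrite lt_neqAle integral_ge0// andbT; apply/eqP => /esym int0.
have [|N [mN muN subN]] :=
    (ae_eq_integral_abs mu mA ((measurable_EFinP _ _).2 mf)).1.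
  rewrite -int0; apply: eq_integral => x; rewrite inE => Ax /=.
  by rewrite gtr0_norm ?f_gt0.
move: muA; rewrite lt_neqAle => /andP[/eqP + _]; apply.
apply/esym/(subset_measure0 mA mN) => // x Ax; apply: subN => /(_ Ax) [] fx0.
by have := f_gt0 x Ax; rewrite fx0 ltxx.
Qed.

Lemma lebesgue_measure_open_gt0 (R : realType) (U : set R) :
  open U -> U !=set0 -> (0 < (@lebesgue_measure R) U)%E.
Proof.
move=> oU [x Ux].
have /nbhs_ballP[e /= e_gt0 ballU] : nbhs x U by exact: open_nbhs_nbhs.
apply: (@lt_le_trans _ _ ((@lebesgue_measure R) (ball x e))).
  by rewrite lebesgue_measure_ball ?ltW// lte_fin pmulrn_lgt0.
apply: le_measure; rewrite ?inE//; first exact: measurable_ball.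
exact: open_measurable.
Qed.

(** The part [sigma] can only add mass, so it suffices that the strictly positive density [g] has
    positive integral over [U], a set of positive Lebesgue measure. *)
Lemma ac_density_open_gt0 (R : realType) (P : probability R R) (I U : set R)
    (g : R -> R) :
  open I -> ac_density_on P I g -> (forall x, I x -> 0 < g x) ->
  open U -> U !=set0 -> U `<=` I -> (0 < P U)%E.
Proof.
move=> oI [mg _ [sigma _ PE]] g_gt0 oU U0 UI.
have mU : measurable U by exact: open_measurable.
rewrite PE//; apply: (lt_le_trans _ (leeDl _ (measure_ge0 sigma U))).
apply: integral_gt0_pos => //.
- by apply: measurable_funS UI mg; exact: open_measurable.
- by move=> x /UI/g_gt0.
- exact: lebesgue_measure_open_gt0.
Qed.

Section exponential_sum.
Context (R : realType) (k : nat).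
Implicit Types (a : 'I_k -> R) (rho : R -> R -> R) (Q : 'I_k -> R).

Lemma exp_sum_gt0 a rho Q (l x : R) :
  is_pmf Q -> 0 < \sum_j Q j * expR (l * rho x (a j)).
Proof.
move=> [Q_ge0 Q_sum].
have t_ge0 j : true -> 0 <= Q j * expR (l * rho x (a j)).
  by rewrite mulr_ge0 ?expR_ge0.
rewrite lt_neqAle sumr_ge0// andbT eq_sym; apply/eqP => /psumr_eq0P t0.
have Q0 j : Q j = 0.
  by have /eqP := t0 t_ge0 j isT; rewrite mulf_eq0 (gt_eqF (expR_gt0 _)) orbF => /eqP.
by move/eqP: Q_sum; rewrite big1// eq_sym oner_eq0.
Qed.

(** The point is that the right-hand side does not depend on [x]. Positivity of the sum is what lets
    [expR] undo [ln]. *)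
Lemma f_fun_eq0 a rho P (D : R) Q (l x : R) :
  is_pmf Q -> f_fun a rho P D Q l x = 0 ->
  \sum_j Q j * expR (l * rho x (a j)) =
  expR (l * D - fine (rate_distortion a rho P D) / log2 (expR 1)).
Proof.
move=> Qpmf /eqP; rewrite subr_eq0 => /eqP f0.
have log2e_neq0 : log2 (expR 1) != 0 :> R.
  by rewrite /log2 expRK mul1r invr_eq0 gt_eqF// ln_gt0// ltr1n.
rewrite -f0 mulrAC mulfV// mul1r subKr lnK//.
by rewrite posrE exp_sum_gt0.
Qed.

Lemma measurable_f_fun a rho P (D : R) Q (l : R) :
  (forall j, measurable_fun [set: R] (fun x => rho x (a j))) ->
  measurable_fun [set: R] (f_fun a rho P D Q l).
Proof.
move=> mrho; apply: measurable_funB => //; apply: measurable_funM => //.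
apply: measurable_funB => //.
apply: (measurableT_comp (@measurable_ln R)).
apply: measurable_sum => j; apply: measurable_funM => //.
apply: (measurableT_comp (@measurable_expR R)).
by apply: measurable_funM => //; exact: mrho.
Qed.

Lemma continuous_exp_sum a rho Q (l x : R) :
  (forall j, {for x, continuous (fun y => rho y (a j))}) ->
  {for x, continuous (fun y => \sum_j Q j * expR (l * rho y (a j)))}.
Proof.
move=> crho; apply: cvg_big => [|j _]; first exact: add_continuous; apply: cvgM; first exact: cvg_cst.
apply: (@continuous_comp _ _ _ (fun y => l * rho y (a j)) expR x).
  by apply: cvgM; [exact: cvg_cst|exact: crho].
exact: continuous_expR.
Qed.

End exponential_sum.

Theorem theorem2 (R : realType) (k : nat) (k_gt0 : (0 < k)%N)
  (a : 'I_k -> R) (a_inj : injective a)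
  (M : R) (rho : R -> R -> R)
  (rho_meas : forall j, measurable_fun [set: R] (fun x => rho x (a j)))
  (rho_bound : forall x j, 0 <= rho x (a j) <= M)
  (rho_supmin : ereal_sup
     [set \big[Order.min/+oo%E]_(j < k) (rho x (a j))%:E | x in [set: R]] = 0%E)
  (P : probability R R)
  (Dmax_gt0 : (0 < D_max a rho P)%E)
  (I : set R) (I_itv : is_interval I) (I_open : open I) (I_neq0 : I !=set0)
  (g : R -> R) (g_dens : ac_density_on P I g)
  (g_gt0 : forall x, I x -> 0 < g x)
  (r_cont : forall j, {within I, continuous (r_fun a rho j)})
  (indep : forall l : R, l < 0 ->
     lin_indep_on I (fun j x => expR (l * r_fun a rho j x)))
  (D : R) (D_gt0 : 0 < D) (D_lt : (D%:E < D_max a rho P)%E)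
  (Q : 'I_k -> R) (l : R) (Ql_opt : optimal_pair a rho P D Q l)
  (d : measure_display) (Omega : measurableType d) (Pr : probability Omega R)
  (X1 : {RV Pr >-> R})
  (X1_law : forall B : set R, measurable B -> distribution Pr X1 B = P B) :
  Pr [set w | f_fun a rho P D Q l (X1 w) = 0] <> 1%E.
Proof.
set S := [set w | _]; move=> PrS.
have [Qpmf _ l_lt0 _] := Ql_opt.
pose h x := \sum_j Q j * expR (l * rho x (a j)).
pose C := expR (l * D - fine (rate_distortion a rho P D) / log2 (expR 1)).
have mF := measurable_f_fun P D Q l rho_meas.
have mS : measurable S.
  have -> : S = X1 @^-1` (f_fun a rho P D Q l @^-1` [set 0]) by [].
  rewrite -[_ @^-1` _]setTI; apply: measurable_funP => //.
  by rewrite -[_ @^-1` _]setTI; apply: mF.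
have h_cont x : I x -> {for x, continuous h}.
  move=> Ix; apply: continuous_exp_sum => j.
  have := r_cont (lift ord0 j).
  (* Since [I] is open, continuity within [I] is ordinary continuity at each of its points. *)
  rewrite continuous_open_subspace// => /(_ x (mem_set Ix)).
  by rewrite /r_fun liftK.
have hC x : I x -> h x = C.
  move=> Ix; apply/eqP/negPn/negP => hx.
  (* Being different from [C] is an open condition, so it persists on a ball around [x] inside
     [I]. *)
  have : nbhs x (I `&` [set y | h y != C]).
    apply: filterI; first exact: open_nbhs_nbhs.
    apply: (h_cont x Ix [set z | z != C]); apply: open_nbhs_nbhs.
    by split => //; exact: open_neq.
  move=> /nbhs_ballP[e /= e_gt0 ballI].
  have PU : (0 < P (ball x e))%E.
    apply: (ac_density_open_gt0 I_open g_dens g_gt0).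
    - exact: ball_open.
    - by exists x; exact: ballxx.
    - by move=> y /ballI[].
  have mU : measurable (ball x e) by exact: measurable_ball.
  have mXU : measurable (X1 @^-1` ball x e).
    by rewrite -[_ @^-1` _]setTI; exact: measurable_funP.
  (* [f_D = 0] would give [h = C], which fails throughout the ball; hence [X1] hits the ball only on
     a null event, although [P] charges it. *)
  have XU_subS : X1 @^-1` ball x e `<=` ~` S.
    by move=> w /ballI[_ /eqP hw] /(f_fun_eq0 Qpmf).
  move: PU; rewrite -X1_law// ltNge => /negP; apply.
  have PrSC : Pr (~` S) = 0%E by rewrite probability_setC// PrS subee.
  rewrite -[leRHS]PrSC; apply: (@le_measure _ _ _ Pr); rewrite ?inE//.
  exact: measurableC.
(* Index 0 carries the constant function [e^(l r_0) = 1], so [h - C = 0] on [I] becomes a linear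
   relation with these coefficients. *)
pose c (j : 'I_k.+1) := if unlift ord0 j is Some i then Q i else - C.
have c0 : forall j, c j = 0.
  apply: (indep l l_lt0 c) => x Ix.
  rewrite big_ord_recl /c /r_fun unlift_none mulr0 expR0 mulr1 -(hC x Ix).
  under eq_bigr do rewrite liftK.
  by rewrite addNr.
have Q0 j : Q j = 0 by have := c0 (lift ord0 j); rewrite /c liftK.
by case: Qpmf => _ /eqP; rewrite big1// eq_sym oner_eq0.
Qed.
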